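(* Let $G$ be a simple graph on $n$ vertices, let $F=\{f_i\}_{i\in[n]}$ be an $L_G(n,k)$-frame for $\mathbb{C}^k$ generated by $G$, and let $\mu_1\ge\mu_2\ge\cdots\ge\mu_k$ be the non-zero eigenvalues (with multiplicity) of the Laplacian matrix of $G$. Then the canonical dual frame of $F$ is $\{Df_1,Df_2,\dots,Df_n\}$, where $D=\operatorname{diag}(\mu_1^{-1},\mu_2^{-1},\dots,\mu_k^{-1})$.
   Context: $[n]=\{1,\dots,n\}$. A sequence $\{f_i\}_{i\in[n]}$ in $\mathbb{C}^k$ is a frame for $\mathbb{C}^k$ if there are constants $A,B>0$ with $A\|f\|^2\le\sum_{i\in[n]}|\langle f,f_i\rangle|^2\le B\|f\|^2$ for all $f\in\mathbb{C}^k$. Its frame operator is $S:\mathbb{C}^k\to\mathbb{C}^k$, $S(f)=\sum_{i\in[n]}\langle f,f_i\rangle f_i$ (inner product linear in the first argument), which is invertible; the canonical dual frame of $\{f_i\}_{i\in[n]}$ is $\{S^{-1}f_i\}_{i\in[n]}$. The Laplacian matrix of a simple graph $G$ with vertices $v_1,\dots,v_n$ is $L=D(G)-A(G)$, where $D(G)$ is the diagonal matrix of vertex degrees and $A(G)$ is the adjacency matrix; it is positive semi-definite. $L_G(n,k)$-frame: let $L$ have rank $k$ with non-zero eigenvalues $\mu_1\ge\cdots\ge\mu_k>0$ (with multiplicity), and let $M$ be a real orthogonal $n\times n$ matrix with $L=M\,\operatorname{diag}(\mu_1,\dots,\mu_k,0,\dots,0)\,M^*$. Let $M_1$ be the $n\times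 k$ matrix formed by the first $k$ columns of $M$, and put $B=\operatorname{diag}(\sqrt{\mu_1},\dots,\sqrt{\mu_k})\,M_1^*$. With $\{e_i\}_{i\in[n]}$ the standard orthonormal basis of $\mathbb{C}^n$, any frame $\{B(e_i)\}_{i\in[n]}$ for $\mathbb{C}^k$ obtained in this way (for some such $M$) is called an $L_G(n,k)$-frame. *)

(* Defs.v *)
From mathcomp Require Import all_boot all_order all_algebra.
From mathcomp Require Import reals.
From mathcomp Require Export complex.

Set Implicit Arguments.
Unset Strict Implicit.
Unset Printing Implicit Defensive.

Import Order.TTheory GRing.Theory Num.Theory.
Local Open Scope ring_scope.
Local Open Scope complex_scope.

(* The complex numbers are R[i] for R : realType; vectors of C^k are columns. *)

(* Linear in the first argument. *)
Definition inner (R : realType) (k : nat) (x y : 'cV[R[i]]_k) : R[i] :=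
  \sum_(j < k) x j ord0 * Num.conj (y j ord0).

(* The order of R[i] compares real parts of numbers with equal imaginary
   parts; all quantities compared below are real. *)
Definition is_frame (R : realType) (n k : nat) (F : 'I_n -> 'cV[R[i]]_k) : Prop :=
  exists a b : R, [/\ 0 < a, 0 < b & forall x : 'cV[R[i]]_k,
    a%:C * inner x x <= \sum_(i < n) `|inner x (F i)| ^+ 2 <= b%:C * inner x x].

Definition frame_op (R : realType) (n k : nat) (F : 'I_n -> 'cV[R[i]]_k)
    (x : 'cV[R[i]]_k) : 'cV[R[i]]_k :=
  \sum_(i < n) inner x (F i) *: F i.

(* T is the two-sided inverse of the frame operator, so g i = S^-1 (F i). *)
Definition is_canonical_dual (R : realType) (n k : nat)
    (F g : 'I_n -> 'cV[R[i]]_k) : Prop :=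
  exists T : 'cV[R[i]]_k -> 'cV[R[i]]_k,
    [/\ cancel (frame_op F) T, cancel T (frame_op F)
      & forall i, g i = T (F i)].

Definition laplacian (R : realType) (n : nat) (e : rel 'I_n) : 'M[R]_n :=
  diag_mx (\row_(i < n) #|[set j | e i j]|%:R) - \matrix_(i, j) (e i j)%:R.

(* mu lists the non-zero eigenvalues of A, each as often as its multiplicity
   as a root of the characteristic polynomial, in non-increasing order. The
   degree of char_poly A forces k <= n, so that n - k is not truncated. *)
Definition nonzero_eigenvalues (R : realType) (n k : nat) (A : 'M[R]_n)
    (mu : k.-tuple R) : Prop :=
  [/\ sorted >=%R mu, 0 \notin mu
    & char_poly A = 'X^(n - k) * \prod_(m <- mu) ('X - m%:P)].

(* As nth defaults to 0, \row_i mu`_i is (mu_1, ..., mu_k, 0, ..., 0).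
   M is real, so its adjoint is its transpose. *)
Definition is_LG_frame (R : realType) (n k : nat) (e : rel 'I_n)
    (F : 'I_n -> 'cV[R[i]]_k) : Prop :=
  let L := laplacian R e in
  \rank L = k /\
  exists (lekn : (k <= n)%N) (mu : k.-tuple R) (M : 'M[R]_n),
    let M1 : 'M[R]_(n, k) := colsub (widen_ord lekn) M in
    let B : 'M[R]_(k, n) :=
      diag_mx (\row_(j < k) Num.sqrt (tnth mu j)) *m M1^T in
    [/\ nonzero_eigenvalues L mu /\ (forall j, 0 < tnth mu j),
        M *m M^T = 1%:M /\ M^T *m M = 1%:M,
        L = M *m diag_mx (\row_(i < n) mu`_i) *m M^T,
        forall i, F i = map_mx (real_complex R) B *m delta_mx i ord0
      & is_frame F].

(* Main.v *)
Require Import Defs.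
From mathcomp Require Import all_boot all_order all_algebra.
From mathcomp Require Import reals.
Import Order.TTheory GRing.Theory Num.Theory.
Local Open Scope ring_scope.
Local Open Scope complex_scope.

(** The frame vectors are the columns of the real matrix
    B = diag(sqrt mu) M1^T, so the frame operator is x |-> B B^* x
    ([frame_op_col]).  The columns of M1 are columns of an orthogonal matrix,
    hence M1^T M1 = 1 and B B^* = diag(sqrt mu) diag(sqrt mu) = diag(mu)
    ([sqrt_diag_mul_trmx]).  The frame operator is therefore multiplication by
    diag(mu), its inverse is multiplication by D = diag(mu^-1), and the
    canonical dual consists of the vectors D f_i.

    The eigenvalue list mu of the theorem is given independently of the one
    used to build the frame; they agree because a polynomial that splits
    determines its roots with multiplicity, and the lists are sorted
    ([nonzero_eigenvalues_unique]). *)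

Lemma nonzero_eigenvalues_unique (R : realType) (n k : nat) (A : 'M[R]_n)
    (mu nu : k.-tuple R) :
  nonzero_eigenvalues A mu -> nonzero_eigenvalues A nu -> mu = nu.
Proof.
move=> [mu_sorted _ charA_mu] [nu_sorted _ charA_nu].
apply/val_inj/(sorted_eq ge_trans ge_anti mu_sorted nu_sorted)/prod_XsubC_eq.
apply: (mulfI (monic_neq0 (monicXn R (n - k)))).
by rewrite -charA_mu -charA_nu.
Qed.

(** Taking inner products with the columns of B is the analysis operator B^*,
    and recombining the columns is the synthesis operator B. *)
Lemma frame_op_col (R : realType) (n k : nat) (B : 'M[R[i]]_(k, n))
    (x : 'cV[R[i]]_k) :
  frame_op (fun i => col i B) x = B *m (map_mx Num.conj B)^T *m x.
Proof.
apply/colP => a; rewrite -mulmxA summxE mxE.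
apply: eq_bigr => i _; rewrite !mxE mulrC; congr (_ * _).
by apply: eq_bigr => j _; rewrite !mxE mulrC.
Qed.

Lemma colsub_orthogonal (R : realType) (n k : nat) (M : 'M[R]_n)
    (f : 'I_k -> 'I_n) :
  injective f -> M^T *m M = 1%:M -> (colsub f M)^T *m colsub f M = 1%:M.
Proof.
move=> f_inj MTM; apply/matrixP => i j.
have /matrixP/(_ (f i) (f j)) := MTM.
rewrite !mxE (inj_eq f_inj) => <-.
by apply: eq_bigr => l _; rewrite !mxE.
Qed.

Lemma sqrt_diag_mul_trmx (R : realType) (n k : nat) (d : 'I_k -> R)
    (M1 : 'M[R]_(n, k)) :
  (forall j, 0 <= d j) -> M1^T *m M1 = 1%:M ->
  let B := diag_mx (\row_j Num.sqrt (d j)) *m M1^T in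
  B *m B^T = diag_mx (\row_j d j).
Proof.
move=> d_ge0 M1TM1 /=.
rewrite trmx_mul trmxK tr_diag_mx -mulmxA (mulmxA M1^T) M1TM1 mul1mx mulmx_diag.
by congr diag_mx; apply/rowP => j; rewrite !mxE -expr2 sqr_sqrtr.
Qed.

Lemma map_conj_real (R : realType) (m n : nat) (B : 'M[R]_(m, n)) :
  map_mx Num.conj (map_mx (real_complex R) B) = map_mx (real_complex R) B.
Proof. by apply/matrixP => i j; rewrite !mxE; apply: conjc_real. Qed.

Lemma diag_mx_invK (K : fieldType) (k : nat) (d : 'I_k -> K) :
  (forall j, d j != 0) ->
  diag_mx (\row_j (d j)^-1) *m diag_mx (\row_j d j) = 1%:M.
Proof.
move=> d_neq0; rewrite mulmx_diag -diag_const_mx.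
by congr diag_mx; apply/rowP => j; rewrite !mxE mulVf.
Qed.

Theorem theorem3p10 (R : realType) (n k : nat) (e : rel 'I_n)
    (F : 'I_n -> 'cV[R[i]]_k) (mu : k.-tuple R)
    (e_sym : symmetric e) (e_irr : irreflexive e)
    (F_LG : is_LG_frame e F)
    (mu_eig : nonzero_eigenvalues (laplacian R e) mu) :
  is_canonical_dual F
    (fun i => diag_mx (\row_(j < k) ((tnth mu j)^-1)%:C) *m F i).
Proof.
case: F_LG => _ [lekn [nu [M [[nu_eig nu_gt0] [_ MTM] _ F_B _]]]].
have mu_nu := nonzero_eigenvalues_unique _ _ _ _ _ _ mu_eig nu_eig.
subst nu.
set B := diag_mx _ *m _ in F_B.
have BBT : B *m B^T = diag_mx (\row_j tnth mu j).
  apply: sqrt_diag_mul_trmx => [j|]; first exact: ltW.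
  by apply: colsub_orthogonal MTM => i j [ij]; apply: val_inj.
have frame_opE x : frame_op F x = diag_mx (\row_j (tnth mu j)%:C) *m x.
  have -> : frame_op F x =
            frame_op (fun i => col i (map_mx (real_complex R) B)) x.
    by apply: eq_bigr => i _; rewrite F_B -colE.
  rewrite frame_op_col map_conj_real map_trmx -map_mxM BBT map_diag_mx.
  by congr (diag_mx _ *m _); apply/rowP => j; rewrite !mxE.
have D_inv : diag_mx (\row_(j < k) ((tnth mu j)^-1)%:C) *m
             diag_mx (\row_j (tnth mu j)%:C) = 1%:M.
  rewrite -[RHS](diag_mx_invK _ _ (fun j => (tnth mu j)%:C)) => [|j].
    by congr (diag_mx _ *m _); apply/rowP => j; rewrite !mxE fmorphV.
  by rewrite fmorph_eq0 gt_eqF.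
exists (mulmx (diag_mx (\row_(j < k) ((tnth mu j)^-1)%:C))).
split=> // x; rewrite frame_opE mulmxA.
  by rewrite D_inv mul1mx.
by rewrite (mulmx1C D_inv) mul1mx.
Qed.
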